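(* Let $\mu$ be a probability measure on $\mathbb{R}^d$. 1. If $\mu$ is $\kappa$-log-concave for some $\kappa\in\mathbb{R}$, $D:=\mathrm{diam}(\mathrm{supp}(\mu))<\infty$, $\kappa D^2<1$, and $e^{\frac{1-\kappa\frac{D^2}{4}}{2}}\frac{D}{2}\le 1$, then $\gamma_d\prec\mu$. 2. If $\mu=\gamma_d^a\star\nu$, where $a>0$, $\gamma_d^a$ is the centered Gaussian measure on $\mathbb{R}^d$ with covariance $a\,\mathrm{I}_d$, $\nu$ is a probability measure on $\mathbb{R}^d$, and $\sqrt{a}\,e^{\frac{\mathrm{diam}(\mathrm{supp}(\nu))^2}{8a}}\le 1$, then $\gamma_d\prec\mu$.
   Context: $\gamma_d$ is the standard Gaussian measure on $\mathbb{R}^d$ and $\star$ denotes convolution of measures. $\kappa$-log-concave: for $\kappa\in\mathbb{R}$ (possibly negative), a probability measure $\mu$ on $\mathbb{R}^d$ is $\kappa$-log-concave if its support is convex, it has a density $\frac{d\mu}{dx}$ with respect to Lebesgue measure which is smooth and positive on the interior of the support, and $-\nabla^2\log\left(\frac{d\mu}{dx}(x)\right)\succeq\kappa\,\mathrm{I}_d$ for $\mu$-almost every $x$. Majorization: for an absolutely continuous measure $\mu$ on $\mathbb{R}^d$ let $F_\mu(\lambda)=\mathrm{Vol}\left(\left\{x:\frac{d\mu}{dx}(x)\ge\lambda\right\}\right)$. We write $\eta\prec\mu$ ($\mu$ majorizes $\eta$) if for every $t\in\mathbb{R}$, $\int_t^\infty F_\eta(\lambda)\,d\lambda\le\int_t^\infty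 F_\mu(\lambda)\,d\lambda$ (values in $[0,\infty]$). *)

(* Defs.v *)
From HB Require Import structures.
From mathcomp Require Import all_boot all_order all_algebra.
From mathcomp Require Import all_classical all_reals all_analysis.

Set Implicit Arguments.
Unset Strict Implicit.
Unset Printing Implicit Defensive.

Import Order.TTheory GRing.Theory Num.Theory.
Import numFieldNormedType.Exports.

Local Open Scope classical_set_scope.
Local Open Scope ring_scope.
Local Open Scope charge_scope.

Section rV_measurable.
Context {disp : measure_display} {T : measurableType disp} (n : nat).

Let coord (i : 'I_n) (x : 'rV[T]_n) : T := x ord0 i.

Let rV_set0 : g_sigma_preimage coord set0.
Proof. exact: sigma_algebra0. Qed.

Let rV_setC A : g_sigma_preimage coord A -> g_sigma_preimage coord (~` A).
Proof. exact: sigma_algebraC. Qed.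

Let rV_bigcup (F : _^nat) : (forall i, g_sigma_preimage coord (F i)) ->
  g_sigma_preimage coord (\bigcup_i (F i)).
Proof. exact: sigma_algebra_bigcup. Qed.

(* The product sigma-algebra, generated by the n coordinate maps; for T = R
   this is the Borel sigma-algebra of R^n. *)
HB.instance Definition _ := @isMeasurable.Build (measure_tuple_display disp)
  'rV[T]_n (g_sigma_preimage coord) rV_set0 rV_setC rV_bigcup.

End rV_measurable.

Section rV_measurable_fun.
Context {d1 d2 : measure_display} {T1 : measurableType d1}
  {T2 : measurableType d2}.

Lemma measurable_coord n (i : 'I_n) :
  measurable_fun [set: 'rV[T2]_n] (fun x : 'rV[T2]_n => x ord0 i).
Proof.
move=> _ Y mY; rewrite setTI; apply: sub_sigma_algebra => /=.
rewrite -bigcup_seq/=; exists i => /=; first by rewrite mem_index_enum.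
by exists Y => //; rewrite setTI.
Qed.

Lemma measurable_fun_rV n (f : T1 -> 'rV[T2]_n) :
  (forall i, measurable_fun [set: T1] (fun x => f x ord0 i)) ->
  measurable_fun [set: T1] f.
Proof.
move=> mf _ A mA; rewrite setTI.
have := @g_sigma_preimage_comp _ _ n _ (fun i (x : 'rV[T2]_n) => x ord0 i) _ f.
suff: g_sigma_preimage (fun i => (fun x : 'rV[T2]_n => x ord0 i) \o f)
   `<=` measurable.
  by move=> H E; apply: H; rewrite E; exists A => //; rewrite setTI.
apply: smallest_sub; first exact: sigma_algebra_measurable.
rewrite -bigcup_seq; apply: bigcup_sub => i _ B [C mC <-].
exact: mf.
Qed.

End rV_measurable_fun.

Section rV_product.
Context {R : realType}.

Definition rV_cons n (z : measurableTypeR R * 'rV[R]_n) : 'rV[R]_n.+1 :=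
  \row_i if unlift ord0 i is Some j then z.2 ord0 j else z.1.

Let rV_split n (x : 'rV[R]_n.+1) : measurableTypeR R * 'rV[R]_n :=
  (x ord0 ord0, \row_j x ord0 (lift ord0 j)).

Let rV_consK n : cancel (@rV_cons n) (@rV_split n).
Proof.
move=> [a v]; congr pair; first by rewrite mxE unlift_none.
by apply/rowP => j; rewrite !mxE liftK.
Qed.

Lemma measurable_rV_cons n : measurable_fun setT (@rV_cons n).
Proof.
apply: measurable_fun_rV => i.
rewrite (_ : (fun _ => _) = fun z : measurableTypeR R * 'rV[R]_n =>
    if unlift ord0 i is Some j then z.2 ord0 j else z.1); last first.
  by apply/funext => z; rewrite mxE.
case: (unlift ord0 i) => [j|]; last exact: measurable_fst.
apply: (measurableT_comp (measurable_coord j)); exact: measurable_snd.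
Qed.

Let measurable_rV_split n : measurable_fun setT (@rV_split n).
Proof.
apply/measurable_fun_pairP; split; first exact: measurable_coord.
apply: measurable_fun_rV => i.
rewrite (_ : (fun _ => _) = (fun x : 'rV[R]_n.+1 => x ord0 (lift ord0 i))).
  exact: measurable_coord.
by apply/funext => x; rewrite /= mxE.
Qed.

Section product.
Context n (m1 : {sigma_finite_measure set (measurableTypeR R) -> \bar R})
  (m2 : {sigma_finite_measure set 'rV[R]_n -> \bar R}).

Definition rV_prod : set 'rV[R]_n.+1 -> \bar R :=
  pushforward (m1 \x m2)%E (@rV_cons n).

Let rV_prod0 : rV_prod set0 = 0%E.
Proof. by rewrite /rV_prod /pushforward preimage_set0 measure0. Qed.

Let rV_prod_ge0 A : (0 <= rV_prod A)%E.
Proof. by apply: integral_ge0 => x _; exact: measure_ge0. Qed.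

Let rV_prod_sigma_additive : semi_sigma_additive rV_prod.
Proof.
pose mf : {mfun _ >-> _} := mfun_Sub (mem_set (@measurable_rV_cons n)).
exact: (@measure_semi_sigma_additive _ _ _ (pushforward (m1 \x m2)%E mf)).
Qed.

HB.instance Definition _ := isMeasure.Build _ _ _
  rV_prod rV_prod0 rV_prod_ge0 rV_prod_sigma_additive.

Let rV_prod_sigma_finite : sigma_finite setT rV_prod.
Proof.
have [F FT Foo] : sigma_finite setT (m1 \x m2)%E.
  have /sigma_finiteP[F [TF ndF Foo]] := sigma_finiteT m1.
  have /sigma_finiteP[G [TG ndG Goo]] := sigma_finiteT m2.
  exists (fun k => F k `*` G k).
    rewrite -setXTT TF TG predeqE => -[x y]; split.
      move=> [/= [i _ Fx] [j _ Gy]]; exists (maxn i j) => //; split.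
      - by move: x Fx; exact/subsetPset/ndF/leq_maxl.
      - by move: y Gy; exact/subsetPset/ndG/leq_maxr.
    by move=> [i _ []/= ? ?]; split; exists i.
  move=> k; have [mF Fk] := Foo k; have [mG Gk] := Goo k.
  split; first exact: measurableX.
  by rewrite product_measure1E// lte_mul_pinfty// ge0_fin_numE.
exists (fun k => @rV_split n @^-1` F k).
  by rewrite -preimage_bigcup -FT preimage_setT.
move=> k; have [mF Fk] := Foo k; split.
  by rewrite -[X in measurable X]setTI; exact: measurable_rV_split.
rewrite /rV_prod /pushforward -comp_preimage.
by rewrite (_ : _ \o _ = id) //; apply/funext => z; exact: rV_consK.
Qed.

HB.instance Definition _ := Measure_isSigmaFinite.Build _ _ _
  rV_prod rV_prod_sigma_finite.

End product.

(* The n-fold product of m with itself. *)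
Fixpoint rV_power (m : {sigma_finite_measure set (measurableTypeR R) -> \bar R})
    n : {sigma_finite_measure set 'rV[R]_n -> \bar R} :=
  match n return {sigma_finite_measure set 'rV[R]_n -> \bar R} with
  | 0 => \d_(0 : 'rV[R]_0)
  | n'.+1 => rV_prod m (rV_power m n')
  end.

End rV_product.

Section measures_on_rV.
Context {R : realType}.

Lemma rV_power_setT (P : probability (measurableTypeR R) R) n :
  rV_power P n setT = 1%E.
Proof.
elim: n => [|n IHn]; first exact: diracT.
rewrite /= /rV_prod /pushforward preimage_setT -setXTT product_measure1E//.
by rewrite [X in (_ * X)%E]IHn mule1; exact: probability_setT.
Qed.

Definition lebesgue_rV d : {sigma_finite_measure set 'rV[R]_d -> \bar R} :=
  rV_power lebesgue_measure d.

(* The centered Gaussian measure with covariance a *: 1%:M (for 0 < a): the law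
   of d independent real Gaussians of variance a. The scale parameter of
   normal_prob is the standard deviation. *)
Definition gaussian d (a : R) : set 'rV[R]_d -> \bar R :=
  rV_power (normal_prob 0 (Num.sqrt a)) d.

Arguments gaussian d a : clear implicits.

HB.instance Definition _ d a := Measure.on (gaussian d a).
HB.instance Definition _ d a := Measure_isProbability.Build _ _ _
  (gaussian d a) (rV_power_setT (normal_prob 0 (Num.sqrt a)) d).

Definition convolution d (mu nu : set 'rV[R]_d -> \bar R) :
    set 'rV[R]_d -> \bar R :=
  pushforward (mu \x nu)%E (fun z : 'rV[R]_d * 'rV[R]_d => z.1 + z.2).

End measures_on_rV.
Arguments gaussian {R} d a.

Section geometry.
Context {R : realType} (d : nat).
Implicit Types (A : set 'rV[R]_d) (f : 'rV[R]_d -> R).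

(* The norm `|x| of x : 'rV[R]_d is the sup norm, hence this definition. *)
Definition euclidean_norm (x : 'rV[R]_d) : R :=
  Num.sqrt (\sum_i x ord0 i ^+ 2).

Definition diam A : \bar R :=
  ereal_sup [set (euclidean_norm (z.1 - z.2))%:E | z in A `*` A].

Definition msupport (mu : set 'rV[R]_d -> \bar R) : set 'rV[R]_d :=
  [set x | forall U, open U -> U x -> (0 < mu U)%E].

Definition partials (s : seq 'I_d) f : 'rV[R]_d -> R :=
  foldr (fun i g x => 'D_(delta_mx ord0 i) g x) f s.

(* C^oo on an open set A: all iterated partial derivatives exist and are
   continuous at every point of A. *)
Definition smooth_on A f :=
  forall (s : seq 'I_d) x, A x ->
    {for x, continuous (partials s f)} /\
    forall i, derivable (partials s f) x (delta_mx ord0 i).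

Definition hessian f (x : 'rV[R]_d) : 'M[R]_d :=
  \matrix_(i, j) partials [:: i; j] f x.

Definition loewner_le (M N : 'M[R]_d) :=
  forall v : 'rV[R]_d, 0 <= (v *m (N - M) *m v^T) ord0 ord0.

End geometry.

Section densities.
Context {R : realType} (d : nat).
Implicit Types mu eta : probability 'rV[R]_d R.

Definition is_density mu (p : 'rV[R]_d -> R) :=
  [/\ measurable_fun setT p, (forall x, 0 <= p x) &
    forall A, measurable A -> mu A = (\int[lebesgue_rV d]_(x in A) (p x)%:E)%E].

Definition kappa_log_concave (kappa : R) mu :=
  convex_set (msupport mu : set (convex_lmodType 'rV[R]_d)) /\
  exists p, [/\ is_density mu p,
    smooth_on (msupport mu)° p,
    (forall x, (msupport mu)° x -> 0 < p x) &
    {ae mu, forall x,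
      loewner_le kappa%:M (- hessian (fun y => ln (p y)) x)}].

(* F_mu(lambda); the Radon-Nikodym derivative is a junk value unless
   mu `<< lebesgue_rV d, which majorized requires of both measures. *)
Definition level_volume mu (lambda : R) : \bar R :=
  lebesgue_rV d [set x |
    (lambda%:E <=
     ('d (charge_of_finite_measure mu) '/d (lebesgue_rV d)) x)%E].

(* eta \prec mu, i.e. mu majorizes eta. *)
Definition majorized eta mu :=
  [/\ eta `<< lebesgue_rV d, mu `<< lebesgue_rV d &
    forall t : R,
      (\int[lebesgue_measure]_(l in `]t, +oo[) level_volume eta l <=
       \int[lebesgue_measure]_(l in `]t, +oo[) level_volume mu l)%E].

End densities.

(* Main.v *)
(* Integrating F_mu over the levels above t gives the integral of (f - t)_+, f the
   density of mu, so gamma_d is majorized by mu iff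
   int (g - t)_+ <= int (f - t)_+ for all t >= 0, g being the density of gamma_d.

   Part 1. The hypotheses give D <= 2, so mu lives on a cube of side 2 and
   int (f - t)_+ >= 1 - t 2^d. Since g <= 2^-d, (g - t)_+ <= (1 - t 2^d)_+ g, which
   integrates to (1 - t 2^d)_+.

   Part 2. The support of nu lies in a cube of side D, D its diameter, and
   f(x) = int prod_i k(x_i - y_i) nu(dy), k the density of N(0, a). The factors are
   replaced one at a time by standard Gaussian ones, integrating over one coordinate
   with the others fixed. Each replacement is the one-dimensional claim, for a
   mixture of the N(y, a), |y - c| <= D/2: on the symmetric interval where
   M g > t, the law N(y, a) with |y| <= D/2 has at least the mass of N(0, 1),
   because the symmetrization of N(y, a) has a density whose ratio to g is a
   multiple of cosh(y x / a) exp(- (1/a - 1) x^2 / 2); by hypothesis it is at least 1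
   at 0, and it is unimodal in |x|, so it crosses 1 at most once. *)

Require Import Defs.
From mathcomp Require Import all_boot all_order all_algebra.
From mathcomp Require Import all_classical all_reals all_analysis.
From mathcomp Require Import measurable_realfun ring lra.

Set Implicit Arguments.
Unset Strict Implicit.
Unset Printing Implicit Defensive.

Import Order.TTheory GRing.Theory Num.Theory.
Import numFieldNormedType.Exports.

Local Open Scope classical_set_scope.
Local Open Scope ring_scope.

(** * Positive parts above a threshold and the layer-cake formula *)

Definition excess {R : realType} (t : R) (u : \bar R) : \bar R :=
  maxe (u - t%:E)%E 0%E.

Section excess.
Context {R : realType}.
Local Open Scope ereal_scope.
Implicit Types (t : R) (u : \bar R).

Lemma excess_ge0 t u : 0 <= excess t u.
Proof. by rewrite le_max lexx orbT. Qed.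

Lemma le_excessD t u : u <= excess t u + t%:E.
Proof. by rewrite -leeBlDr// /excess le_max lexx. Qed.

Lemma measurable_excess d (T : measurableType d) t (f : T -> \bar R) :
  measurable_fun setT f -> measurable_fun setT (fun x => excess t (f x)).
Proof. by move=> mf; apply: measurable_maxe => //; exact: emeasurable_funB. Qed.

(** Tonelli on the set [A] of pairs [(l, x)] with [t < l <= p x]: its section at a level [l > t] is
    a level set of [p], and its section at [x] is the interval []t, p x]], of length
    [(p x - t)_+]. *)
Lemma integral_level d (T : measurableType d)
    (m : {sigma_finite_measure set T -> \bar R}) (p : T -> R) t :
  measurable_fun setT p ->
  \int[lebesgue_measure]_(l in `]t, +oo[) m [set x | (l <= p x)%R] =
  \int[m]_x excess t (p x)%:E.
Proof.
move=> mp.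
pose A := [set z : measurableTypeR R * T | (t < z.1)%R /\ (z.1 <= p z.2)%R].
have mA : measurable A.
  have -> : A = (fst @^-1` `]t, +oo[%classic) `&`
      ((fun z : measurableTypeR R * T => p z.2 - z.1)%R @^-1` `[0%R, +oo[%classic).
    by apply/seteqP; split=> z /=; rewrite !in_itv/= !andbT subr_ge0.
  have mB : measurable_fun setT (fun z : measurableTypeR R * T => p z.2 - z.1)%R.
    by apply: measurable_funB; [exact: measurableT_comp|exact: measurable_fst].
  apply: measurableI; rewrite -[X in measurable X]setTI.
    exact: measurable_fst.
  exact: mB.
transitivity (\int[lebesgue_measure]_l (m \o xsection A) l).
  rewrite integral_mkcond; apply: eq_integral => l _; rewrite patchE.
  case: ifPn => [|]; rewrite ?notin_setE ?inE /= in_itv/= andbT => lt.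
    congr (m _); apply/seteqP; split=> x; rewrite /xsection/= inE/= /A/=.
      by [].
    by case.
  rewrite [xsection _ _](_ : _ = set0) ?measure0//.
  by apply/seteqP; split=> x //; rewrite /xsection/= inE => -[].
rewrite -indic_fubini_tonelli_FE// indic_fubini_tonelli// indic_fubini_tonelli_GE//.
apply: eq_integral => x _ /=.
rewrite [ysection _ _](_ : _ = `]t, p x]%classic); last first.
  apply/seteqP; split=> l; rewrite /ysection/= inE /A/= in_itv/=.
    by move=> [-> ->].
  by move=> /andP[].
rewrite lebesgue_measure_itv/= lte_fin /excess -EFinB -EFin_max.
case: ltP => H; congr EFin; apply/esym.
  by apply/max_idPl; lra.
by apply/max_idPr; lra.
Qed.

End excess.

(** * Majorization in terms of densities *)

Section majorization_densities.
Context {R : realType} {d : nat}.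
Local Open Scope ereal_scope.
Implicit Types (mu eta : probability 'rV[R]_d R) (p f g : 'rV[R]_d -> R).

Lemma density_dominates mu p : is_density mu p -> mu `<< lebesgue_rV d.
Proof.
move=> [mp p0 muE]; apply/null_content_dominatesP => A mA A0.
rewrite muE//; apply: null_set_integral => //.
by apply: measurable_funTS; exact/measurable_EFinP.
Qed.

(** [level_volume] is built on the Radon-Nikodym derivative. That derivative has the same integral
    as [p] on every measurable set, so the two agree almost everywhere. *)
Lemma integral_level_volume mu p t : is_density mu p ->
  \int[lebesgue_measure]_(l in `]t, +oo[) level_volume mu l =
  \int[lebesgue_rV d]_x excess t (p x)%:E.
Proof.
move=> dp; have mu_leb := density_dominates dp; have [mp p0 muE] := dp.
set rn : 'rV[R]_d -> \bar R :=
  Radon_Nikodym (charge_of_finite_measure mu) (lebesgue_rV d).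
have rnfin x : rn x \is a fin_num by exact: Radon_Nikodym_fin_num.
have mrn : measurable_fun setT rn.
  by apply: (measurable_int (lebesgue_rV d)); exact: Radon_Nikodym_integrable.
have mp' : measurable_fun setT (fun x => (p x)%:E) by exact/measurable_EFinP.
have : ae_eq (lebesgue_rV d) setT rn (fun x => (p x)%:E).
  apply: integral_ae_eq => //; first exact: Radon_Nikodym_integrable.
  move=> A _ mA; rewrite -muE//.
  by rewrite -Radon_Nikodym_integral.
(* [integral_level] takes a real-valued function; [fine] loses nothing, the derivative being finite
   at every point. *)
move=> rnp; transitivity (\int[lebesgue_rV d]_x excess t (fine (rn x))%:E).
  rewrite -integral_level//; last exact: measurableT_comp.
  apply: eq_integral => l _; congr (lebesgue_rV d _); apply/seteqP.
  by split=> x /=; rewrite -/rn -lee_fin fineK.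
apply: ge0_ae_eq_integral => //.
- apply: measurable_excess; apply/measurable_EFinP; exact: measurableT_comp.
- exact: measurable_excess.
- by move=> x _; exact: excess_ge0.
- by move=> x _; exact: excess_ge0.
- by move: rnp; apply: filterS => x /(_ I) rnp _; rewrite fineK// rnp.
Qed.

(** Thresholds [t < 0] take care of themselves: a density [p >= 0] then has [(p - t)_+ = p - t],
    whose integral is 1 plus that of [- t], the same value for both measures. *)
Lemma majorized_of_density eta mu g f :
    is_density eta g -> is_density mu f ->
    (forall t, (0 <= t)%R -> \int[lebesgue_rV d]_x excess t (g x)%:E <=
                            \int[lebesgue_rV d]_x excess t (f x)%:E) ->
  majorized eta mu.
Proof.
move=> dg df gf; split; [exact: density_dominates dg|
  exact: density_dominates df|] => t.
rewrite (integral_level_volume t dg) (integral_level_volume t df).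
have [/gf//|t0] := leP 0%R t.
suff E (nu : probability 'rV[R]_d R) p : is_density nu p ->
    \int[lebesgue_rV d]_x excess t (p x)%:E =
    1 + \int[lebesgue_rV d]_x (- t)%:E by rewrite (E _ _ dg) (E _ _ df).
move=> [mp p0 nuE]; have <- : nu setT = 1 by exact: probability_setT.
rewrite nuE// -ge0_integralD//; last 3 first.
- by move=> x _; rewrite lee_fin.
- exact/measurable_EFinP.
- by move=> x _; rewrite lee_fin; lra.
apply: eq_integral => x _; rewrite /excess -EFinB -EFin_max.
by congr EFin; apply/max_idPl; have := p0 x; lra.
Qed.

End majorization_densities.

(** * Hyperbolic inequalities and a unimodal ratio *)

Section cosh_gauss.
Context {R : realType}.
Implicit Types p q u v x z : R.

(** Twice the hyperbolic sine; [chc] is twice the hyperbolic cosine. *)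
Let shc u : R := expR u - expR (- u).
Let chc u : R := expR u + expR (- u).

Let is_derive_shc u : is_derive u 1 shc (chc u).
Proof.
rewrite /shc /chc; apply: is_derive_eq.
by rewrite /GRing.scale/=; ring.
Qed.

Let chc_le u v : 0 <= u <= v -> chc u <= chc v.
Proof.
move=> /andP[u0 uv]; rewrite /chc !expRN.
have : 1 <= expR u by rewrite -expR0 ler_expR.
have : expR u <= expR v by rewrite ler_expR.
move: (expR u) (expR v) => a b ab a1.
rewrite -subr_ge0 (_ : _ - _ = (b - a) * (a * b - 1) / (a * b)); last first.
  by field; lra.
by rewrite divr_ge0 ?mulr_ge0//; nra.
Qed.

(** The quotient [shc u / u] increases on the positive axis: the slopes of [shc] over [[0, u]] and
    [[u, v]] are values of [chc] at points [x1 <= x2], and [chc] increases. *)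
Let shc_star u v : 0 < u <= v -> v * shc u <= u * shc v.
Proof.
move=> /andP[u0]; rewrite le_eqVlt => /predU1P[->//|uv].
have dS x : derivable shc x 1 by exact: ex_derive.
have cS : continuous shc by move=> x; apply/differentiable_continuous/derivable1_diffP.
have [x1 x1I e1] := MVT u0 (fun x _ => is_derive_shc x) (continuous_subspaceT cS).
have [x2 x2I e2] := MVT uv (fun x _ => is_derive_shc x) (continuous_subspaceT cS).
have s0 : shc 0 = 0 by rewrite /shc oppr0 subrr.
have := @chc_le x1 x2; move: x1I x2I; rewrite !in_itv/= => /andP[? ?] /andP[? ?] H.
have {}H : chc x1 <= chc x2 by apply: H; lra.
have -> : shc v = shc u + chc x2 * (v - u) by lra.
have -> : shc u = chc x1 * u by move: e1; rewrite s0 !subr0.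
have : 0 <= u * (v - u) * (chc x2 - chc x1).
  by apply: mulr_ge0; [apply: mulr_ge0|]; rewrite ?subr_ge0 //; exact: ltW.
by lra.
Qed.

(** This is [tanh q / q <= tanh p / p] without denominators. By the addition formulas it is
    [shc_star] at the points [q - p] and [q + p]. *)
Let tanh_star p q : 0 <= p <= q -> p * (shc q * chc p) <= q * (shc p * chc q).
Proof.
move=> /andP[p0]; rewrite le_eqVlt => /predU1P[->//|pq].
have := @shc_star (q - p) (q + p).
have -> : shc (q - p) = (shc q * chc p - shc p * chc q) / 2.
  by rewrite /shc /chc opprB !expRD; field.
have -> : shc (q + p) = (shc q * chc p + shc p * chc q) / 2.
  by rewrite /shc /chc opprD !expRD; field.
by move=> H; have {}H := H _; lra.
Qed.

(* N' u has the sign of b tanh (b u) - 2 c u, and tanh v / v decreases. *)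
Lemma cosh_gauss_unimodal (b c x z : R) : 0 <= x <= z ->
  let N u := (expR (b * u) + expR (- (b * u))) * expR (- (c * u ^+ 2)) in
  2 <= N x \/ N z <= N x.
Proof.
move=> /andP[x0 xz] N.
have [//|Nx2] := leP 2 (N x); first by left.
have [//|Nxz] := leP (N z) (N x); first by right.
exfalso.
pose N' u := (b * shc (b * u) - 2 * c * u * chc (b * u)) * expR (- (c * u ^+ 2)).
have dN u : is_derive u 1 N (N' u).
  rewrite /N /N' /shc /chc; apply: is_derive_eq.
  by rewrite /GRing.scale/=; ring.
have cN : continuous N by move=> y; apply/differentiable_continuous/derivable1_diffP.
have N0 : N 0 = 2 by rewrite /N expr0n /= !mulr0 !oppr0 !expR0 mulr1.
have x_gt0 : 0 < x.
  rewrite lt_neqAle x0 andbT; apply/eqP => x00; move: Nx2; rewrite -x00 N0 ltxx//.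
have xz' : x < z.
  by rewrite lt_neqAle xz andbT; apply/eqP => xz'; move: Nxz; rewrite xz' ltxx.
(* Since [N 0 = 2] and [N x] lies below both [N 0] and [N z], the derivative is negative at some [p]
   before [x] and positive at some [q] after it. *)
have [p pI ep] := MVT x_gt0 (fun x _ => dN x) (continuous_subspaceT cN).
have [q qI eq] := MVT xz' (fun x _ => dN x) (continuous_subspaceT cN).
move: pI qI; rewrite !in_itv/= => /andP[p0 px] /andP[xq qz].
have : N' p < 0 by rewrite N0 in ep; nra.
have : 0 < N' q by nra.
rewrite /N' pmulr_lgt0 ?expR_gt0// pmulr_llt0 ?expR_gt0// => Nq Np.
have cp : 0 < chc (b * p) by rewrite addr_gt0 ?expR_gt0.
have cq : 0 < chc (b * q) by rewrite addr_gt0 ?expR_gt0.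
(* The two signs say that [b tanh (b p) / p < 2 c < b tanh (b q) / q], whereas [tanh_star] gives the
   opposite order. *)
have : (b * p) * (shc (b * q) * chc (b * p)) <= (b * q) * (shc (b * p) * chc (b * q)).
  have pq : p <= q by lra.
  have [b0|/ltW b0] := leP 0 b.
    by apply: tanh_star; rewrite mulr_ge0 ?ler_wpM2l ?(ltW p0).
  (* For [b <= 0] the inequality is taken at the opposite points; on each side the signs of the
     linear factor and of [shc] cancel. *)
  have H : 0 <= - (b * p) <= - (b * q).
    by rewrite oppr_ge0 lerN2 ler_wnM2l// mulr_le0_ge0 ?(ltW p0).
  have := @tanh_star _ _ H.
  have chN u : chc (- u) = chc u by rewrite /chc opprK addrC.
  have shN u : shc (- u) = - shc u by rewrite /shc opprK opprB.
  rewrite !chN !shN.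
  by lra.
have H1 : (b * shc (b * p) - 2 * c * p * chc (b * p)) * (q * chc (b * q)) < 0.
  by rewrite pmulr_llt0// mulr_gt0//; lra.
have H2 : 0 < (b * shc (b * q) - 2 * c * q * chc (b * q)) * (p * chc (b * p)).
  by rewrite mulr_gt0// mulr_gt0//; lra.
by nra.
Qed.

End cosh_gauss.

(** * Reflection and translation invariance of Lebesgue integrals *)

Section lebesgue_symmetries.
Context {R : realType}.
Local Open Scope ereal_scope.

Lemma ge0_integral_lebesgueN (f : R -> \bar R) :
  measurable_fun [set: R] f -> (forall x, 0 <= f x) ->
  \int[lebesgue_measure]_x f (- x)%R = \int[lebesgue_measure]_x f x.
Proof.
move=> mf f0; transitivity
    (\int[pushforward lebesgue_measure (-%R : _ -> measurableTypeR R)]_x f x).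
  by rewrite ge0_integral_pushforward.
by apply: eq_measure_integral => //= A mA _; exact: lebesgue_measureN.
Qed.

Lemma ge0_integral_lebesgueD (c : R) (f : R -> \bar R) :
  measurable_fun [set: R] f -> (forall x, 0 <= f x) ->
  \int[lebesgue_measure]_x f (x + c)%R = \int[lebesgue_measure]_x f x.
Proof.
move=> mf f0.
have mc : measurable_fun setT (fun x : R => (x + c)%R : measurableTypeR R).
  exact: measurable_funD.
transitivity (\int[pushforward lebesgue_measure
                   (fun x : R => (x + c)%R : measurableTypeR R)]_x f x).
  by rewrite ge0_integral_pushforward.
apply: eq_measure_integral => //= A mA _; apply/esym.
apply: lebesgue_measure_unique => //= _ [[a b]] _ <-.
rewrite /pushforward (_ : _ @^-1` _ = `](a - c)%R, (b - c)%R]%classic); last first.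
  by apply/seteqP; split=> x /=; rewrite !in_itv/= ltrBlDr lerBrDr.
rewrite !lebesgue_measure_itv/= !lte_fin ltrD2r; case: ifP => // _.
by rewrite -!EFinD; congr EFin; ring.
Qed.

End lebesgue_symmetries.

(** * Symmetric intervals under a shifted normal law and under the standard one *)

Section normal_comparison.
Context {R : realType}.
Variables (y s : R).
Hypotheses (s_gt0 : 0 < s) (s_le : s * expR (y ^+ 2 / (2 * s ^+ 2)) <= 1).

(** Density of the symmetrization of the normal law of mean [y] and deviation [s]; both give the
    same mass to a symmetric set. *)
Let q u : R := (normal_pdf y s u + normal_pdf y s (- u)) / 2.

(** The ratio of [q] to the standard normal density at 0; [s_le] says exactly that it is at least
    1. *)
Let C : R := s^-1 * expR (- (y ^+ 2 / (2 * s ^+ 2))).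

(** The dependence of that ratio on [u], normalized by [N 0 = 2], in the form treated by
    [cosh_gauss_unimodal]. *)
Let N (u : R) : R := (expR (y / s ^+ 2 * u) + expR (- (y / s ^+ 2 * u))) *
  expR (- ((s ^- 2 - 1) / 2 * u ^+ 2)).

Let C_ge1 : 1 <= C.
Proof.
rewrite /C expRN -invfM invf_ge1 ?mulr_gt0 ?expR_gt0//.
Qed.

Let qE u : q u = normal_pdf 0 1 u * (C * N u / 2).
Proof.
rewrite /q !normal_pdfE ?oner_eq0 ?gt_eqF// /normal_peak /normal_fun.
rewrite expr1n mul1r subr0 -mulrnAr sqrtrM ?sqr_ge0// sqrtr_sqr gtr0_norm//.
rewrite /C /N invfM.
have -> : - (u - y) ^+ 2 / (s ^+ 2 *+ 2) = - u ^+ 2 / 2 +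
    (- (y ^+ 2 / (2 * s ^+ 2)) + (y / s ^+ 2 * u +
      - ((s ^- 2 - 1) / 2 * u ^+ 2))) by field; rewrite gt_eqF.
have -> : - (- u - y) ^+ 2 / (s ^+ 2 *+ 2) = - u ^+ 2 / 2 +
    (- (y ^+ 2 / (2 * s ^+ 2)) + (- (y / s ^+ 2 * u) +
      - ((s ^- 2 - 1) / 2 * u ^+ 2))) by field; rewrite gt_eqF.
by rewrite !expRD; ring.
Qed.

Let N_abs u : N `|u| = N u.
Proof.
have [u0|u0] := leP 0 u; first by rewrite ger0_norm.
by rewrite ltr0_norm// /N sqrrN mulrN opprK [X in X * _]addrC.
Qed.

(* Once q falls below the standard Gaussian density, it stays below. *)
Let q_crossing x z : `|x| <= `|z| -> normal_pdf 0 1 z <= q z ->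
  normal_pdf 0 1 x <= q x.
Proof.
have G0 u : 0 < normal_pdf (0:R) 1 u.
  by rewrite normal_pdfE ?oner_eq0// mulr_gt0 ?normal_peak_gt0 ?oner_eq0 ?expR_gt0.
move=> xz; rewrite !qE !ler_pMr ?G0// !ler_pdivlMr// !mul1r.
rewrite -(N_abs z) -(N_abs x) => z2.
(* The claim has become [2 <= C * N x], given [2 <= C * N z]. It follows from [C >= 1] if
   [2 <= N x], and from the inequality at [z] if [N z <= N x]. *)
have [|//|] := @cosh_gauss_unimodal R (y / s ^+ 2) ((s ^- 2 - 1) / 2) `|x| `|z|.
- by rewrite normr_ge0.
- by move=> x2; rewrite (le_trans x2)// ler_peMl ?C_ge1// (le_trans _ x2).
- by move=> zx; rewrite (le_trans z2)// ler_wpM2l// (le_trans ler01 C_ge1).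
Qed.

Let normal_sym (m t : R) (A : set R) : measurable A ->
  (forall x, A x -> A (- x)) ->
  (\int[lebesgue_measure]_(x in A) (normal_pdf m t (- x))%:E =
   \int[lebesgue_measure]_(x in A) (normal_pdf m t x)%:E)%E.
Proof.
move=> mA symA; rewrite [LHS]integral_mkcond [RHS]integral_mkcond.
rewrite -[RHS]ge0_integral_lebesgueN.
- apply: eq_integral => x _; rewrite !patchE.
  suff -> : (- x \in A) = (x \in A) by [].
  by apply/idP/idP; rewrite !inE => /symA; rewrite ?opprK.
- apply: (iffLR (measurable_restrictT _ mA)); apply: measurable_funTS.
  apply/measurable_EFinP. exact: measurable_normal_pdf.
- by move=> x; rewrite patchE; case: ifP => // _; rewrite lee_fin normal_pdf_ge0.
Qed.

Let mq : measurable_fun [set: R] q.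
Proof.
apply: measurable_funM => //; apply: measurable_funD.
  exact: measurable_normal_pdf.
by apply: measurableT_comp => //; exact: measurable_normal_pdf.
Qed.

Let q_ge0 x : 0 <= q x.
Proof. by rewrite divr_ge0// addr_ge0 ?normal_pdf_ge0. Qed.

Let normal_probE (A : set R) : measurable A -> (forall x, A x -> A (- x)) ->
  (normal_prob y s A = \int[lebesgue_measure]_(x in A) (q x)%:E)%E.
Proof.
move=> mA symA; rewrite /q.
have mp : measurable_fun A (fun x => (normal_pdf y s x)%:E).
  by apply/measurable_funTS/measurable_EFinP; exact: measurable_normal_pdf.
have mpN : measurable_fun A (fun x => (normal_pdf y s (- x))%:E).
  apply/measurable_funTS/measurable_EFinP.
  by apply: measurableT_comp => //; exact: measurable_normal_pdf.
under eq_integral do rewrite EFinM EFinD.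
rewrite ge0_integralZr//; last 2 first.
- exact: emeasurable_funD.
- by move=> x _; rewrite -EFinD lee_fin addr_ge0 ?normal_pdf_ge0.
rewrite ge0_integralD//; last 2 first.
- by move=> x _; rewrite lee_fin normal_pdf_ge0.
- by move=> x _; rewrite lee_fin normal_pdf_ge0.
rewrite (normal_sym y s mA symA) -/(normal_prob y s A).
have : normal_prob y s A \is a fin_num by exact: fin_num_measure.
move=> /fineK <-; rewrite -EFinD -EFinM; by congr EFin; field.
Qed.

(** Such an [A] is an interval symmetric about 0, possibly empty or the whole line. The superlevel
    sets of the standard normal density have this form. *)
Lemma normal_prob_symmetric_le (A : set R) : measurable A ->
  (forall x z, A z -> `|x| <= `|z| -> A x) ->
  (normal_prob 0 1 A <= normal_prob y s A)%E.
Proof.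
move=> mA downA.
have symA x : A x -> A (- x) by move=> /downA; apply; rewrite normrN.
have symAC x : (~` A) x -> (~` A) (- x).
  by apply: contra_not => /symA; rewrite opprK.
have mpdf (m t : R) B : measurable_fun B (fun x : R => (normal_pdf m t x)%:E).
  by apply/measurable_funTS/measurable_EFinP; exact: measurable_normal_pdf.
have mqB B : measurable_fun B (fun x : R => (q x)%:E).
  by apply/measurable_funTS/measurable_EFinP.
(* If q beats the Gaussian density outside A, it does so everywhere on A;
   otherwise it puts less mass on the complement of A. *)
have [[z Az qz]|H] := pselect (exists2 z, ~ A z & normal_pdf 0 1 z <= q z).
  rewrite normal_probE//; apply: ge0_le_integral => //.
  - by move=> x _; rewrite lee_fin normal_pdf_ge0.
  - exact: mpdf.
  - exact: mqB.
  - move=> x Ax; rewrite lee_fin; apply: (@q_crossing x z) => //.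
    by rewrite leNgt; apply/negP => /ltW zx; apply: Az; exact: downA Ax zx.
have : (normal_prob y s (~` A) <= normal_prob 0 1 (~` A))%E.
  rewrite normal_probE//; last exact: measurableC.
  apply: ge0_le_integral => //.
  - exact: measurableC.
  - by move=> x _; rewrite lee_fin.
  - exact: mqB.
  - exact: mpdf.
  - move=> x Ax; rewrite lee_fin leNgt; apply/negP => /ltW qx.
    by apply: H; exists x.
have mpC (m t : R) : (normal_prob m t (~` A) = 1 - normal_prob m t A)%E.
  exact: (probability_setC (normal_prob m t) mA).
rewrite (mpC y s) (mpC 0 1) leeD2lE; last by [].
by rewrite leeN2.
Qed.

End normal_comparison.

(** * Mixtures of normal laws on the line *)

Section mixture1.
Context {R : realType}.
Local Open Scope ereal_scope.

Lemma measurable_normal_pdf2 d (T : measurableType d) (s : R) (m u : T -> R) :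
  s != 0%R -> measurable_fun setT m -> measurable_fun setT u ->
  measurable_fun setT (fun x => normal_pdf (m x) s (u x)).
Proof.
move=> s0 mm mu; under eq_fun do rewrite normal_pdfE//.
apply: measurable_funM => //; apply: measurableT_comp => //.
apply: measurable_funM => //; apply: measurableT_comp => //.
by apply: measurable_funX; exact: measurable_funB.
Qed.

Lemma normal_pdfD (m s x c : R) : s != 0%R ->
  normal_pdf m s (x + c)%R = normal_pdf (m - c)%R s x.
Proof. by move=> s0; rewrite !normal_pdfE// /normal_fun opprB addrA. Qed.

Lemma normal_pdf_decr (s x z : R) : s != 0%R -> (`|x| <= `|z|)%R ->
  (normal_pdf 0 s z <= normal_pdf 0 s x)%R.
Proof.
move=> s0 xz; rewrite !normal_pdfE// ler_wpM2l ?normal_peak_ge0// ler_expR !subr0.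
by rewrite ler_wpM2r ?invr_ge0 ?mulrn_wge0 ?sqr_ge0// lerN2
  -(real_normK (num_real x)) -(real_normK (num_real z)) lerXn2r.
Qed.

(** The weight [w] is there to hold the factors of the other coordinates, so its mass [M] is any
    finite number. Let [g] and [f] be the two densities compared and [A] the set where [g > t]. The
    left side equals the integral of [g - t] over [A], the right side is at least that of [f - t],
    and [f] has at least the mass of [g] on [A], because each normal law in the mixture does. *)
Lemma excess_mixture1 d (Y : measurableType d)
    (nu : {sigma_finite_measure set Y -> \bar R}) (w : Y -> \bar R)
    (y : Y -> R) (c b s t : R) :
  (0 < s)%R -> (s * expR (b ^+ 2 / (2 * s ^+ 2)) <= 1)%R -> (0 <= t)%R ->
  measurable_fun setT w -> (forall o, 0 <= w o) -> \int[nu]_o w o < +oo ->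
  measurable_fun setT y -> (forall o, w o != 0 -> (`|y o - c| <= b)%R) ->
  \int[lebesgue_measure]_u
     excess t ((\int[nu]_o w o) * (normal_pdf 0 1 u)%:E) <=
  \int[lebesgue_measure]_u
     excess t (\int[nu]_o (w o * (normal_pdf (y o) s u)%:E)).
Proof.
move=> s0 sb t0 mw w0 wfin my yb; set M := \int[nu]_o w o.
have M0 : 0 <= M by exact: integral_ge0.
have sN0 : s != 0%R by rewrite gt_eqF.
(* Translating by [c] keeps the integral over [u] and brings the means into [[- b, b]]. *)
pose F (z : measurableTypeR R * Y) := w z.2 * (normal_pdf (y z.2 - c)%R s z.1)%:E.
have mF : measurable_fun setT F.
  apply: emeasurable_funM; first exact: measurableT_comp.
  apply/measurable_EFinP; apply: measurable_normal_pdf2 => //.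
  by apply: measurable_funB => //; exact: measurableT_comp.
have F0 z : 0 <= F z by rewrite mule_ge0// lee_fin normal_pdf_ge0.
pose f (u : R) := \int[nu]_o F (u, o).
have mf : measurable_fun [set: R] f by exact: (measurable_fun_fubini_tonelli_F F).
have -> : \int[lebesgue_measure]_u
     excess t (\int[nu]_o (w o * (normal_pdf (y o) s u)%:E)) =
   \int[lebesgue_measure]_u excess t (f u).
  pose f0 (u : R) := \int[nu]_o (w o * (normal_pdf (y o) s u)%:E).
  have f0D u : f0 (u + c)%R = f u.
    by apply: eq_integral => o _; rewrite normal_pdfD.
  have mf0 : measurable_fun [set: R] f0.
    have -> : f0 = fun u => f (u - c)%R by apply/funext => u; rewrite -f0D subrK.
    by apply: measurableT_comp => //; exact: measurable_funB.
  transitivity (\int[lebesgue_measure]_u excess t (f0 (u + c)%R)).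
    apply/esym/(@ge0_integral_lebesgueD R c (fun u => excess t (f0 u))).
    - exact: measurable_excess.
    - by move=> u; exact: excess_ge0.
  by apply: eq_integral => u _; rewrite f0D.
pose g (u : R) := M * (normal_pdf 0 1 u)%:E.
have mG : measurable_fun [set: R] (fun u : R => (normal_pdf 0 1 u)%:E).
  by apply/measurable_EFinP; exact: measurable_normal_pdf.
have G0 u : 0 <= (normal_pdf (0 : R) 1 u)%:E by rewrite lee_fin normal_pdf_ge0.
have mg : measurable_fun [set: R] g by exact: emeasurable_funM.
have g0 u : 0 <= g u by rewrite mule_ge0.
pose A := [set u : R | t%:E < g u].
have mA : measurable A.
  by rewrite -[A]setTI; exact: emeasurable_fun_o_infty.
have downA x z : A z -> (`|x| <= `|z|)%R -> A x.
  move=> /lt_le_trans tz xz; apply: tz.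
  by apply: lee_wpmul2l => //; rewrite lee_fin normal_pdf_decr// oner_eq0.
have mt : measurable_fun A (cst t%:E : R -> \bar R) by exact: measurable_cst.
have tA_ge0 : 0 <= \int[lebesgue_measure]_(u in A) t%:E.
  by apply: integral_ge0 => u _; rewrite lee_fin.
have gA : \int[lebesgue_measure]_(u in A) g u = M * normal_prob 0 1 A.
  by rewrite ge0_integralZl//; exact: measurable_funTS.
(* Markov's inequality: [t < g] on [A], and [g] has finite mass. Finiteness allows this term to be
   added to both sides in place of a subtraction. *)
have tA_fin : \int[lebesgue_measure]_(u in A) t%:E \is a fin_num.
  rewrite ge0_fin_numE//; apply: (@le_lt_trans _ _ (M * normal_prob 0 1 A)).
    rewrite -gA; apply: ge0_le_integral => //.
    - exact: measurable_funTS.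
    - by move=> u /ltW.
  by rewrite lte_mul_pinfty// ?ge0_fin_numE// (le_lt_trans (probability_le1 _ _))// ltry.
have -> : \int[lebesgue_measure]_u excess t (g u) =
          \int[lebesgue_measure]_(u in A) excess t (g u).
  rewrite [RHS]integral_mkcond; apply: eq_integral => u _; rewrite patchE.
  case: ifPn => // /negP; rewrite inE /A/= => /negP; rewrite -leNgt => gt.
  by apply/max_idPr; rewrite leeBlDr// add0e.
rewrite -(leeD2rE _ _ tA_fin).
have exD h : measurable_fun [set: R] h -> (forall u, 0 <= h u) ->
    \int[lebesgue_measure]_(u in A) excess t (h u) +
    \int[lebesgue_measure]_(u in A) t%:E =
    \int[lebesgue_measure]_(u in A) (excess t (h u) + t%:E).
  move=> mh h0; rewrite ge0_integralD//.
  - by move=> u _; exact: excess_ge0.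
  - by apply: measurable_funTS; exact: measurable_excess.
(* Restricting the right side to [A] can only lower it. *)
apply: (@le_trans _ _ (\int[lebesgue_measure]_(u in A) excess t (f u) +
    \int[lebesgue_measure]_(u in A) t%:E)); last first.
  apply: leeD2r; apply: ge0_subset_integral => //.
    exact: measurable_excess.
  by move=> u _; exact: excess_ge0.
have f_ge0 u : 0 <= f u by exact: integral_ge0.
rewrite !exD//.
apply: (@le_trans _ _ (\int[lebesgue_measure]_(u in A) f u)); last first.
  apply: ge0_le_integral => //.
  - exact: measurable_funTS.
  - apply: emeasurable_funD => //; apply: measurable_funTS.
    exact: measurable_excess.
  - by move=> u _; exact: le_excessD.
have -> : \int[lebesgue_measure]_(u in A) (excess t (g u) + t%:E) =
          \int[lebesgue_measure]_(u in A) g u.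
  apply: eq_integral => u /[!inE] /ltW gu; rewrite /excess.
  rewrite (max_idPl _) ?subeK//.
  by rewrite leeBrDr// add0e.
rewrite gA.
(* Tonelli turns the mass of [f] on [A] into a mixture over [o] of the masses that the centred
   normal laws give to [A]. *)
pose H (z : measurableTypeR R * Y) := (\1_A z.1)%:E * F z.
have mH : measurable_fun setT H.
  apply: emeasurable_funM => //; apply/measurable_EFinP.
  by apply: measurableT_comp.
have H0 z : 0 <= H z by rewrite mule_ge0 ?lee_fin.
have HE o : \int[lebesgue_measure]_u H (u, o) = w o * normal_prob (y o - c)%R s A.
  transitivity (\int[lebesgue_measure]_u
      (w o * ((normal_pdf (y o - c)%R s u)%:E * (\1_A u)%:E))).
    by apply: eq_integral => u _; rewrite /H /F /= muleC -muleA.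
  rewrite ge0_integralZl; [|by []| | |by []].
  + congr (_ * _); rewrite /normal_prob [RHS]integral_mkcond.
    apply: eq_integral => u _.
    by rewrite patchE indicE; case: ifP; rewrite (mule1, mule0).
  + apply: emeasurable_funM; last exact/measurable_EFinP.
    by apply/measurable_EFinP; exact: measurable_normal_pdf.
  + by move=> u _; rewrite mule_ge0 ?lee_fin ?normal_pdf_ge0.
have -> : \int[lebesgue_measure]_(u in A) f u =
          \int[nu]_o (w o * normal_prob (y o - c)%R s A).
  transitivity (\int[lebesgue_measure]_u ((\1_A u)%:E * f u)).
    rewrite integral_mkcond; apply: eq_integral => u _.
    by rewrite patchE indicE; case: ifP; rewrite (mul1e, mul0e).
  transitivity (\int[lebesgue_measure]_u \int[nu]_o H (u, o)).
    apply: eq_integral => u _; rewrite /f -ge0_integralZl//.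
    exact: measurableT_comp.
  by rewrite (fubini_tonelli H)//; apply: eq_integral => o _; exact: HE.
have P0 : 0 <= normal_prob (0 : R) 1 A by exact: measure_ge0.
have -> : M * normal_prob 0 1 A = \int[nu]_o (w o * normal_prob 0 1 A).
  by rewrite ge0_integralZr.
apply: ge0_le_integral; first exact: measurableT.
- by move=> o _; apply: mule_ge0.
- by apply: emeasurable_funM; [exact: mw|exact: measurable_cst].
- under eq_fun do rewrite -HE.
  exact: (measurable_fun_fubini_tonelli_G H).
(* The mean is confined only where the weight is nonzero; elsewhere both sides vanish. *)
move=> o _; have [->|wo] := eqVneq (w o) 0; first by rewrite !mul0e.
apply: lee_wpmul2l; first exact: w0.
apply: normal_prob_symmetric_le; [exact: s0| |exact: mA|exact: downA].
rewrite (le_trans _ sb)// ler_wpM2l ?(ltW s0)// ler_expR.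
apply: ler_wpM2r; first by rewrite invr_ge0 mulr_ge0 ?sqr_ge0.
rewrite -(real_normK (num_real (_ - _)%R)).
by rewrite lerXn2r ?nnegrE// ?yb// (le_trans _ (yb _ wo)).
Qed.

End mixture1.

(** * Product normal densities, coordinate by coordinate *)

Section normal_rV.
Context {R : realType}.
Local Open Scope ereal_scope.

Lemma ge0_integral_rV_cons (m : {sigma_finite_measure set (measurableTypeR R) -> \bar R})
    n (F : 'rV[R]_n.+1 -> \bar R) :
  measurable_fun setT F -> (forall x, 0 <= F x) ->
  \int[rV_power m n.+1]_x F x =
  \int[m]_u \int[rV_power m n]_v F (rV_cons (u, v)).
Proof.
move=> mF F0.
have mc := @measurable_rV_cons R n.
rewrite -[LHS]/(\int[pushforward (m \x rV_power m n) (@rV_cons R n)]_x F x).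
rewrite ge0_integral_pushforward//= fubini_tonelli1//.
exact: measurableT_comp.
Qed.

Definition row_tail n (x : 'rV[R]_n.+1) : 'rV[R]_n :=
  \row_j x ord0 (lift ord0 j).

Definition normal_rV n (m : 'rV[R]_n) (s : R) (x : 'rV[R]_n) : R :=
  (\prod_i normal_pdf (m ord0 i) s (x ord0 i))%R.

Lemma normal_rV_ge0 n (m : 'rV[R]_n) s x : (0 <= normal_rV m s x)%R.
Proof. by apply: prodr_ge0 => i _; exact: normal_pdf_ge0. Qed.

Lemma normal_rV_cons n (m : 'rV[R]_n.+1) s (u : R) v :
  normal_rV m s (rV_cons (u, v)) =
  (normal_pdf (m ord0 ord0) s u * normal_rV (row_tail m) s v)%R.
Proof.
rewrite /normal_rV big_ord_recl mxE unlift_none; congr (_ * _)%R.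
by apply: eq_bigr => i _; rewrite !mxE liftK.
Qed.

Lemma measurable_normal_rV d (T : measurableType d) n (s : R)
    (m x : T -> 'rV[R]_n) : s != 0%R ->
  measurable_fun setT m -> measurable_fun setT x ->
  measurable_fun setT (fun z => normal_rV (m z) s (x z)).
Proof.
move=> s0 mm mx; apply: measurable_prod => i _.
apply: measurable_normal_pdf2 => //.
  exact: (measurableT_comp (measurable_coord i) mm).
exact: (measurableT_comp (measurable_coord i) mx).
Qed.

Lemma measurable_row_tail n : measurable_fun setT (@row_tail n).
Proof.
apply: measurable_fun_rV => i; under eq_fun do rewrite mxE.
exact: measurable_coord.
Qed.

End normal_rV.

(** * The mixture comparison in every dimension *)

Section mixture.
Context {R : realType}.
Local Open Scope ereal_scope.

(** Induction on [n], for all weights at once. Between the two sides stands [Phi u * Gn v], with the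
    mixed first coordinate and a standard Gaussian tail. For fixed [v], [excess_mixture1] with
    weight [w o * Gn v] compares it with the left side; for fixed [u], the induction hypothesis with
    weight [w o * k o u] compares it with the right side. *)
Lemma excess_mixture d (Y : measurableType d)
    (nu : {sigma_finite_measure set Y -> \bar R}) (b s t : R) n
    (w : Y -> \bar R) (y : Y -> 'rV[R]_n) (c : 'rV[R]_n) :
  (0 < s)%R -> (s * expR (b ^+ 2 / (2 * s ^+ 2)) <= 1)%R -> (0 <= t)%R ->
  measurable_fun setT w -> (forall o, 0 <= w o) -> \int[nu]_o w o < +oo ->
  measurable_fun setT y ->
  (forall o i, w o != 0 -> (`|y o ord0 i - c ord0 i| <= b)%R) ->
  \int[lebesgue_rV n]_x
     excess t ((\int[nu]_o w o) * (normal_rV 0 1 x)%:E) <=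
  \int[lebesgue_rV n]_x
     excess t (\int[nu]_o (w o * (normal_rV (y o) s x)%:E)).
Proof.
move=> s0 sb t0; have sN0 : s != 0%R by rewrite gt_eqF.
elim: n w y c => [|n IHn] w y c mw w0 wfin my yb.
  rewrite le_eqVlt; apply/orP; left; apply/eqP.
  apply: eq_integral => x _; congr (excess t _).
  rewrite /normal_rV big_ord0 mule1.
  by apply: eq_integral => o _; rewrite big_ord0 mule1.
set M := \int[nu]_o w o.
have M0 : 0 <= M by apply: integral_ge0 => o _; exact: w0.
pose k o u : \bar R := (normal_pdf (y o ord0 ord0) s u)%:E.
have k0 o u : 0 <= k o u by rewrite lee_fin normal_pdf_ge0.
pose K o v : \bar R := (normal_rV (row_tail (y o)) s v)%:E.
have K0 o v : 0 <= K o v by rewrite lee_fin normal_rV_ge0.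
pose G u : \bar R := (normal_pdf 0 1 u)%:E.
have G0 u : 0 <= G u by rewrite lee_fin normal_pdf_ge0.
pose Gn v : \bar R := (@normal_rV R n 0 1 v)%:E.
have Gn0 v : 0 <= Gn v by rewrite lee_fin normal_rV_ge0.
have my0 : measurable_fun setT (fun o => y o ord0 ord0).
  exact: (measurableT_comp (measurable_coord ord0) my).
have mk : measurable_fun setT (fun z : measurableTypeR R * Y => k z.2 z.1).
  apply/measurable_EFinP; apply: measurable_normal_pdf2; [exact: sN0| |].
    exact: (measurableT_comp my0 measurable_snd).
  exact: measurable_fst.
have mK : measurable_fun setT (fun z : 'rV[R]_n * Y => K z.2 z.1).
  apply/measurable_EFinP; apply: measurable_normal_rV; [exact: sN0| |].
    apply: (measurableT_comp (measurable_row_tail (n := n))).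
    exact: (measurableT_comp my measurable_snd).
  exact: measurable_fst.
have mG : measurable_fun [set: R] G.
  by apply/measurable_EFinP; exact: measurable_normal_pdf.
have mGn : measurable_fun setT Gn.
  apply/measurable_EFinP; apply: measurable_normal_rV.
  - exact: oner_neq0.
  - exact: measurable_cst.
  - exact: measurable_id.
have mwk : measurable_fun setT
    (fun z : measurableTypeR R * Y => w z.2 * k z.2 z.1).
  by apply: emeasurable_funM; [exact: (measurableT_comp mw measurable_snd)|exact: mk].
have wk0 o u : 0 <= w o * k o u by apply: mule_ge0.
have rVE (m : 'rV[R]_n.+1) r u v : (normal_rV m r (rV_cons (u, v)))%:E =
    (normal_pdf (m ord0 ord0) r u)%:E * (normal_rV (row_tail m) r v)%:E.
  by rewrite normal_rV_cons EFinM.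
have tail0 : row_tail (0%R : 'rV[R]_n.+1) = 0%R.
  by apply/rowP => i; rewrite !mxE.
(* The first coordinate is made the inner integral, so that the first comparison can be done at
   fixed [v]. *)
have -> : \int[lebesgue_rV n.+1]_x excess t (M * (normal_rV 0 1 x)%:E) =
    \int[lebesgue_rV n]_v \int[lebesgue_measure]_u excess t (M * (G u * Gn v)).
  rewrite ge0_integral_rV_cons; last 2 first.
  - apply: measurable_excess; apply: measurable_funeM.
    apply/measurable_EFinP; apply: measurable_normal_rV.
    + exact: oner_neq0.
    + exact: measurable_cst.
    + exact: measurable_id.
  - by move=> x; exact: excess_ge0.
  transitivity (\int[lebesgue_measure]_u \int[lebesgue_rV n]_v
      excess t (M * (G u * Gn v))).
    apply: eq_integral => u _; apply: eq_integral => v _.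
    by rewrite rVE tail0 mxE.
  apply: (fubini_tonelli (fun z : measurableTypeR R * 'rV[R]_n =>
    excess t (M * (G z.1 * Gn z.2)))).
  - apply: measurable_excess; apply: measurable_funeM; apply: emeasurable_funM.
      exact: (measurableT_comp mG measurable_fst).
    exact: (measurableT_comp mGn measurable_snd).
  - by move=> z; exact: excess_ge0.
have -> : \int[lebesgue_rV n.+1]_x
      excess t (\int[nu]_o (w o * (normal_rV (y o) s x)%:E)) =
    \int[lebesgue_measure]_u \int[lebesgue_rV n]_v
      excess t (\int[nu]_o ((w o * k o u) * K o v)).
  rewrite ge0_integral_rV_cons; last 2 first.
  - apply: measurable_excess.
    apply: (measurable_fun_fubini_tonelli_F
      (fun z : 'rV[R]_n.+1 * Y => w z.2 * (normal_rV (y z.2) s z.1)%:E)).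
      apply: emeasurable_funM; first exact: (measurableT_comp mw measurable_snd).
      apply/measurable_EFinP; apply: measurable_normal_rV; first exact: sN0.
        exact: (measurableT_comp my measurable_snd).
      exact: measurable_fst.
    by move=> z; rewrite mule_ge0// lee_fin normal_rV_ge0.
  - by move=> x; exact: excess_ge0.
  apply: eq_integral => u _; apply: eq_integral => v _; congr (excess t _).
  by apply: eq_integral => o _; rewrite rVE muleA.
pose Phi u := \int[nu]_o (w o * k o u).
have mPhi : measurable_fun [set: R] Phi.
  exact: (measurable_fun_fubini_tonelli_F
    (fun z : measurableTypeR R * Y => w z.2 * k z.2 z.1)).
have mPsi : measurable_fun setT (fun z : measurableTypeR R * 'rV[R]_n =>
    excess t (Phi z.1 * Gn z.2)).
  apply: measurable_excess; apply: emeasurable_funM.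
    exact: (measurableT_comp mPhi measurable_fst).
  exact: (measurableT_comp mGn measurable_snd).
have mwku u : measurable_fun setT (fun o => w o * k o u).
  exact: (measurableT_comp mwk (measurable_pair1 u)).
apply: (@le_trans _ _ (\int[lebesgue_rV n]_v \int[lebesgue_measure]_u
    excess t (Phi u * Gn v))).
  apply: ge0_le_integral; first exact: measurableT.
  - by move=> v _; apply: integral_ge0 => u _; exact: excess_ge0.
  - apply: (measurable_fun_fubini_tonelli_G (m1 := lebesgue_measure)
      (fun z : measurableTypeR R * 'rV[R]_n => excess t (M * (G z.1 * Gn z.2)))).
      apply: measurable_excess; apply: measurable_funeM; apply: emeasurable_funM.
        exact: (measurableT_comp mG measurable_fst).
      exact: (measurableT_comp mGn measurable_snd).
    by move=> z; exact: excess_ge0.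
  - apply: (measurable_fun_fubini_tonelli_G (m1 := lebesgue_measure)
      (fun z : measurableTypeR R * 'rV[R]_n => excess t (Phi z.1 * Gn z.2))).
      exact: mPsi.
    by move=> z; exact: excess_ge0.
  move=> v _.
  have wG : \int[nu]_o (w o * Gn v) = M * Gn v.
    by apply: ge0_integralZr => //; exact: measurableT.
  have wkG u : \int[nu]_o (w o * Gn v * k o u) = Phi u * Gn v.
    rewrite -ge0_integralZr//.
    by apply: eq_integral => o _; rewrite muleAC.
  have := @excess_mixture1 R _ Y nu (fun o => w o * Gn v)
    (fun o => y o ord0 ord0) (c ord0 ord0) b s t s0 sb t0.
  rewrite wG.
  have -> : \int[lebesgue_measure]_u
      excess t (\int[nu]_o (w o * Gn v * (normal_pdf (y o ord0 ord0) s u)%:E)) =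
    \int[lebesgue_measure]_u excess t (Phi u * Gn v).
    by apply: eq_integral => u _; rewrite -wkG.
  have -> : \int[lebesgue_measure]_u excess t (M * Gn v * (normal_pdf 0 1 u)%:E) =
    \int[lebesgue_measure]_u excess t (M * (G u * Gn v)).
    by apply: eq_integral => u _; rewrite muleAC -muleA.
  apply.
  - by apply: emeasurable_funM; [exact: mw|exact: measurable_cst].
  - by move=> o; exact: mule_ge0.
  - by rewrite lte_mul_pinfty ?ltry// ge0_fin_numE.
  - exact: my0.
  - move=> o wo; apply: yb; apply: contra wo => /eqP ->.
    by rewrite mul0e.
(* The order of integration is exchanged for the second comparison, at fixed [u]. *)
rewrite -(fubini_tonelli (m1 := lebesgue_measure)
  (fun z : measurableTypeR R * 'rV[R]_n => excess t (Phi z.1 * Gn z.2))); last 2 first.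
- exact: mPsi.
- by move=> z; exact: excess_ge0.
have m13 : measurable_fun setT
    (fun z : (measurableTypeR R * 'rV[R]_n) * Y => (z.1.1, z.2)).
  apply: measurable_fun_pair; last exact: measurable_snd.
  exact: (measurableT_comp measurable_fst measurable_fst).
have m23 : measurable_fun setT
    (fun z : (measurableTypeR R * 'rV[R]_n) * Y => (z.1.2, z.2)).
  apply: measurable_fun_pair; last exact: measurable_snd.
  exact: (measurableT_comp measurable_snd measurable_fst).
apply: ge0_le_integral; first exact: measurableT.
- by move=> u _; apply: integral_ge0 => v _; exact: excess_ge0.
- apply: (measurable_fun_fubini_tonelli_F
    (fun z : measurableTypeR R * 'rV[R]_n => excess t (Phi z.1 * Gn z.2))).
    exact: mPsi.
  by move=> z; exact: excess_ge0.
- apply: (measurable_fun_fubini_tonelli_F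
    (fun z : measurableTypeR R * 'rV[R]_n =>
       excess t (\int[nu]_o (w o * k o z.1 * K o z.2)))).
    apply: measurable_excess.
    apply: (measurable_fun_fubini_tonelli_F
      (fun z : (measurableTypeR R * 'rV[R]_n) * Y =>
        w z.2 * k z.2 z.1.1 * K z.2 z.1.2)).
      apply: emeasurable_funM.
        exact: (measurableT_comp mwk m13).
      exact: (measurableT_comp mK m23).
    by move=> z; apply: mule_ge0.
  by move=> z; exact: excess_ge0.
move=> u _.
have := IHn (fun o => w o * k o u) (fun o => row_tail (y o)) (row_tail c).
rewrite -/(Phi u) => IHu.
change (\int[lebesgue_rV n]_v excess t (Phi u * Gn v) <=
  \int[lebesgue_rV n]_v excess t (\int[nu]_o (w o * k o u * K o v))).
apply: IHu.
- exact: mwku.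
- by move=> o; exact: wk0.
(* The new weight still has finite mass, the normal density being bounded by its peak. *)
- apply: (@le_lt_trans _ _ (M * (normal_peak s)%:E)).
    rewrite -ge0_integralZr//; last by rewrite lee_fin normal_peak_ge0.
    apply: ge0_le_integral; first exact: measurableT.
    + by move=> o _.
    + exact: mwku.
    + by apply: emeasurable_funM; [exact: mw|exact: measurable_cst].
    + by move=> o _; apply: lee_wpmul2l; rewrite ?w0// lee_fin normal_pdf_ub.
  by rewrite lte_mul_pinfty ?ltry// ge0_fin_numE.
- exact: (measurableT_comp (measurable_row_tail (n := n)) my).
- move=> o i wo; rewrite !mxE; apply: yb; apply: contra wo => /eqP ->.
  by rewrite mul0e.
Qed.

End mixture.

(** * Shifted Gaussian integrals as Lebesgue integrals *)

Section gaussian_density.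
Context {R : realType}.
Local Open Scope ereal_scope.

(** The formula holds for the Radon-Nikodym derivative, and [p] equals that derivative almost
    everywhere, having the same integral on every measurable set. *)
Lemma ge0_integral_density d (T : measurableType d)
    (m : {finite_measure set T -> \bar R})
    (mu : {sigma_finite_measure set T -> \bar R}) (p F : T -> \bar R) :
  measurable_fun setT p -> (forall x, 0 <= p x) ->
  (forall A, measurable A -> m A = \int[mu]_(x in A) p x) ->
  measurable_fun setT F -> (forall x, 0 <= F x) ->
  \int[m]_x F x = \int[mu]_x (F x * p x).
Proof.
move=> mp p0 mE mF F0.
have m_mu : m `<< mu.
  apply/null_content_dominatesP => A mA A0; rewrite mE//.
  by apply: null_set_integral => //; exact: measurable_funTS.
rewrite -(Radon_Nikodym_SigmaFinite.change_of_variables m_mu F0 measurableT mF).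
have fi := Radon_Nikodym_SigmaFinite.f_integrable m_mu.
have mf := measurable_int _ fi.
have : ae_eq mu setT (Radon_Nikodym_SigmaFinite.f m mu) p.
  apply: integral_ae_eq => // A _ mA.
  by rewrite -mE// -Radon_Nikodym_SigmaFinite.f_integral.
move=> fp; apply: ge0_ae_eq_integral => //.
- exact: emeasurable_funM.
- exact: emeasurable_funM.
- by move=> x _; rewrite mule_ge0// Radon_Nikodym_SigmaFinite.f_ge0.
- by move=> x _; rewrite mule_ge0.
- by move: fp; apply: filterS => x /(_ I) -> _.
Qed.

Lemma ge0_integral_normal_probD (s c : R) (F : R -> \bar R) : s != 0%R ->
  measurable_fun [set: R] F -> (forall x, 0 <= F x) ->
  \int[normal_prob 0 s]_u F (u + c)%R =
  \int[lebesgue_measure]_u (F u * (normal_pdf c s u)%:E).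
Proof.
move=> s0 mF F0.
have mpdf (m : R) : measurable_fun [set: R] (fun u => (normal_pdf m s u)%:E).
  by apply/measurable_EFinP; exact: measurable_normal_pdf.
have pdf0 (m u : R) : 0 <= (normal_pdf m s u)%:E by rewrite lee_fin normal_pdf_ge0.
rewrite (@ge0_integral_density _ _ (normal_prob 0 s) lebesgue_measure
  (fun u => (normal_pdf 0 s u)%:E) (fun u : R => F (u + c)%R)).
- rewrite -(@ge0_integral_lebesgueD R c
    (fun u => F u * (normal_pdf c s u)%:E)).
  + by apply: eq_integral => u _; rewrite normal_pdfD// subrr.
  + exact: emeasurable_funM.
  + by move=> u; exact: mule_ge0.
- exact: mpdf.
- exact: pdf0.
- by move=> A mA.
- by apply: measurableT_comp => //; exact: measurable_funD.
- by move=> u; exact: F0.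
Qed.

Lemma rV_consD n u v (y : 'rV[R]_n.+1) :
  (rV_cons (u, v) + y = rV_cons (u + y ord0 ord0, v + row_tail y))%R.
Proof.
apply/rowP => i; rewrite !mxE; case: unliftP => [j ->|->] //=.
by rewrite !mxE.
Qed.

Lemma measurable_fun_addrV d (T : measurableType d) n (f g : T -> 'rV[R]_n) :
  measurable_fun setT f -> measurable_fun setT g ->
  measurable_fun setT (fun x => (f x + g x)%R).
Proof.
move=> mf mg; apply: measurable_fun_rV => i; under eq_fun do rewrite mxE.
apply: measurable_funD.
  exact: (measurableT_comp (measurable_coord i) mf).
exact: (measurableT_comp (measurable_coord i) mg).
Qed.

(** The shift by [y] is the form met in a convolution once the second variable is fixed; it becomes
    the mean of the density. Induction on [n], one coordinate at a time. *)
Lemma ge0_integral_normal_rVD n (s : R) (y : 'rV[R]_n) (F : 'rV[R]_n -> \bar R) :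
  s != 0%R -> measurable_fun setT F -> (forall x, 0 <= F x) ->
  \int[rV_power (normal_prob 0 s) n]_x F (x + y)%R =
  \int[lebesgue_rV n]_x (F x * (normal_rV y s x)%:E).
Proof.
move=> s0; elim: n y F => [|n IHn] y F mF F0.
  apply: eq_integral => x _; rewrite /normal_rV big_ord0 mule1.
  by congr F; apply/rowP => -[].
have mK : measurable_fun setT (fun v => (normal_rV (row_tail y) s v)%:E).
  by apply/measurable_EFinP; exact: measurable_normal_rV.
have K0 v : 0 <= (normal_rV (row_tail y) s v)%:E by rewrite lee_fin normal_rV_ge0.
have mFc : measurable_fun setT
    (fun z : measurableTypeR R * 'rV[R]_n => F (rV_cons z)).
  exact: (measurableT_comp mF (@measurable_rV_cons _ n)).
have mFcu u : measurable_fun setT (fun v => F (rV_cons (u, v))).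
  exact: (measurableT_comp mFc (measurable_pair1 u)).
pose H u := \int[lebesgue_rV n]_v
  (F (rV_cons (u, v)) * (normal_rV (row_tail y) s v)%:E).
have mH : measurable_fun [set: R] H.
  apply: (measurable_fun_fubini_tonelli_F
    (fun z : measurableTypeR R * 'rV[R]_n =>
      F (rV_cons z) * (normal_rV (row_tail y) s z.2)%:E)).
    apply: emeasurable_funM; first exact: mFc.
    exact: (measurableT_comp mK measurable_snd).
  by move=> z; apply: mule_ge0.
have H0 u : 0 <= H u.
  by apply: integral_ge0 => v _; apply: mule_ge0.
rewrite ge0_integral_rV_cons; last 2 first.
- by apply: (measurableT_comp mF); apply: measurable_fun_addrV.
- by move=> x; exact: F0.
transitivity (\int[normal_prob 0 s]_u H (u + y ord0 ord0)%R).
  apply: eq_integral => u _.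
  under eq_integral do rewrite rV_consD.
  rewrite (IHn (row_tail y) (fun v => F (rV_cons (u + y ord0 ord0, v)%R)))//.
rewrite ge0_integral_normal_probD// ge0_integral_rV_cons; last 2 first.
- apply: emeasurable_funM => //; apply/measurable_EFinP.
  exact: measurable_normal_rV.
- by move=> x; rewrite mule_ge0// lee_fin normal_rV_ge0.
apply: eq_integral => u _; rewrite -ge0_integralZr//; last 3 first.
- exact: emeasurable_funM.
- by move=> v _; exact: mule_ge0.
- by rewrite lee_fin normal_pdf_ge0.
apply: eq_integral => v _; rewrite normal_rV_cons EFinM.
by rewrite -muleA; congr (_ * _); rewrite muleC.
Qed.

End gaussian_density.

(** * Cubes and their measurability *)

Section cubes.
Context {R : realType} {d : nat}.
Implicit Types (c x : 'rV[R]_d) (b : R).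

(** A closed ball of the sup norm, written by coordinates because the mixture comparison bounds each
    coordinate separately. *)
Definition cube c b : set 'rV[R]_d :=
  [set x | forall i, `|x ord0 i - c ord0 i| <= b].

Lemma measurable_cube c b : measurable (cube c b).
Proof.
have -> : cube c b = \bigcap_(i in [set: 'I_d])
    [set x | `|x ord0 i - c ord0 i| <= b].
  by apply/seteqP; split=> x H i; [move=> _; exact: H|exact: (H i I)].
apply: fin_bigcap_measurable => // i _.
rewrite [X in measurable X](_ : _ =
    (fun x => `|x ord0 i - c ord0 i|) @^-1` `]-oo, b]%classic); last first.
  by apply/seteqP; split=> x /=; rewrite in_itv.
rewrite -[X in measurable X]setTI.
have : measurable_fun setT (fun x : 'rV[R]_d => `|x ord0 i - c ord0 i|).
  apply: measurableT_comp => //; apply: measurable_funB => //.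
  exact: measurable_coord.
by apply.
Qed.

End cubes.

(** * Open sets and supports *)

Section support.
Context {R : realType} {d : nat}.
Implicit Types (nu : probability 'rV[R]_d R) (q : 'rV[rat]_d) (U : set 'rV[R]_d).

(** There are only countably many of these, so unions of boxes stay measurable and unions of null
    boxes stay null. *)
Let box q (n : nat) : set 'rV[R]_d := cube (map_mx ratr q) n.+1%:R^-1.

Let box_basis U x : open U -> U x ->
  exists q n, box q n x /\ box q n `<=` U.
Proof.
move=> oU Ux; have /nbhs_ballP[e /= e0 xeU] : nbhs x U by exact: open_nbhs_nbhs.
(* Half of [e], since [x] and any point of the box are each within [n.+1%:R^-1] of the centre. *)
have [n ne] : exists n, n.+1%:R^-1 < e / 2.
  have e2 : 0 < e / 2 by rewrite divr_gt0.
  by have [n] := ltr_add_invr e2; rewrite add0r; exists n.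
have n0 : 0 < n.+1%:R^-1 :> R by rewrite invr_gt0.
have qP i : exists r : rat, `|x ord0 i - ratr r| < n.+1%:R^-1.
  have [r rI] := @rat_in_itvoo R (x ord0 i) (x ord0 i + n.+1%:R^-1) (ltr_pwDr n0 (lexx _)).
  exists r; move: rI; rewrite in_itv/= => /andP[xr rx].
  rewrite ltr_norml; move: n0 xr rx; move: (ratr r) (x ord0 i) (_^-1) => u v c.
  by move=> c0 vu uc; apply/andP; split; lra.
have [r rP] := choice qP.
exists (\row_i r i), n; split=> [i|y yB]; first by rewrite !mxE ltW.
apply: xeU; split=> // j i; rewrite (ord1 j) /ball/=.
have := yB i; rewrite !mxE => yr; have xr := rP i.
rewrite (_ : _ - _ = (x ord0 i - ratr (r i)) - (y ord0 i - ratr (r i))); last by ring.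
rewrite (le_lt_trans (ler_normB _ _))//; move: ne xr yr.
by move: `|_| `|_| (_ ^-1) => u v c; lra.
Qed.

(** The sigma-algebra is generated by the coordinates; an open set belongs to it as the union of the
    countably many boxes it contains. *)
Lemma open_measurable_rV U : open U -> measurable U.
Proof.
(* [unpickle] enumerates the pairs of a rational centre and an index; a code of no pair yields the
   empty set. *)
move=> oU; pose F k := if @unpickle ('rV[rat]_d * nat)%type k is Some z then
  (if `[< box z.1 z.2 `<=` U >] then box z.1 z.2 else set0) else set0.
rewrite (_ : U = \bigcup_k F k).
  apply: bigcupT_measurable => k; rewrite /F.
  by case: unpickle => [z|//]; case: asboolP => // _; exact: measurable_cube.
apply/seteqP; split=> [x Ux|x [k _]].
  have [q [n [qx qU]]] := box_basis oU Ux.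
  by exists (pickle (q, n)) => //; rewrite /F pickleK/=; case: asboolP.
by rewrite /F; case: unpickle => [z|//]; case: asboolP => // + zx; exact.
Qed.

(** A point outside the support has a null open neighbourhood, hence lies in a null box, and the
    null boxes are countably many. *)
Lemma negligible_msupportC nu : nu.-negligible (~` msupport nu).
Proof.
pose F k := if @unpickle ('rV[rat]_d * nat)%type k is Some z then
  (if nu (box z.1 z.2) == 0%E then box z.1 z.2 else set0) else set0.
apply: (@negligibleS _ _ _ _ (\bigcup_k F k)).
  move=> x /=; rewrite /msupport/= => /existsNP[U] /not_implyP[oU].
  move=> /not_implyP[Ux nuU].
  have [q [n [qx qU]]] := box_basis oU Ux.
  exists (pickle (q, n)) => //; rewrite /F pickleK/=.
  suff -> : nu (box q n) = 0%E by rewrite eqxx.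
  apply/eqP; rewrite eq_le measure_ge0 andbT; rewrite leNgt; apply/negP => qn.
  apply: nuU; apply: (lt_le_trans qn); apply: le_measure => //; rewrite inE.
    exact: measurable_cube.
  exact: open_measurable_rV.
apply: negligible_bigcup => k; rewrite /F; case: unpickle => [z|].
  case: ifPn => [/eqP z0|_]; last exact: negligible_set0.
  by apply/negligibleP => //; exact: measurable_cube.
exact: negligible_set0.
Qed.

End support.

(** * Diameters and enclosing cubes *)

Section diameter.
Context {R : realType} {d : nat}.
Implicit Types (A : set 'rV[R]_d) (c x : 'rV[R]_d) (b D : R).

Lemma le_euclidean_norm x i : `|x ord0 i| <= euclidean_norm x.
Proof.
rewrite /euclidean_norm -sqrtr_sqr ler_wsqrtr// (bigD1 i)//= lerDl.
by apply: sumr_ge0 => j _; exact: sqr_ge0.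
Qed.

Lemma diam_cube A D : (diam A <= D%:E)%E -> exists c, A `<=` cube c (D / 2).
Proof.
move=> AD; have [[x0 Ax0]|A0] := pselect (A !=set0); last first.
  by exists 0 => x Ax; exfalso; apply: A0; exists x.
have AD' x y i : A x -> A y -> x ord0 i - y ord0 i <= D.
  move=> Ax Ay; rewrite -lee_fin; apply: le_trans AD.
  apply: (@le_trans _ _ (euclidean_norm (x - y))%:E); last first.
    by apply: ereal_sup_ubound; exists (x, y).
  rewrite lee_fin; apply: le_trans (le_euclidean_norm (x - y) i).
  by rewrite !mxE ler_norm.
pose S i := [set x ord0 i | x in A].
(* Each coordinate projection of the set has length at most [D], so it lies between [sup (S i) - D]
   and [sup (S i)]; the centre is the midpoint. *)
exists (\row_i (sup (S i) - D / 2)) => x Ax i; rewrite mxE.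
have S0 : S i !=set0 by exists (x ord0 i), x.
have ubS y : A y -> ubound (S i) (y ord0 i + D).
  by move=> Ay _ [z Az <-]; have := AD' z y i Az Ay; lra.
have xS : x ord0 i <= sup (S i).
  by apply: ub_le_sup; [exists (x ord0 i + D); exact: ubS|exists x].
have Sx : sup (S i) <= x ord0 i + D by apply: ge_sup => //; exact: ubS.
by rewrite ler_norml; apply/andP; split; lra.
Qed.

Lemma msupport_cube_ae (nu : probability 'rV[R]_d R) c b :
  msupport nu `<=` cube c b -> {ae nu, forall x, cube c b x}.
Proof.
move=> sub; apply: negligibleS (negligible_msupportC nu).
by apply: subsetC.
Qed.

End diameter.

(** * Densities of the Gaussian measure and of its convolutions *)

Section densities.
Context {R : realType}.
Local Open Scope ereal_scope.

Lemma gaussian_density d (a : R) : (0 < a)%R ->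
  is_density (gaussian d a) (normal_rV 0 (Num.sqrt a)).
Proof.
move=> a0; have s0 : Num.sqrt a != 0%R by rewrite gt_eqF// sqrtr_gt0.
have mK : measurable_fun setT (@normal_rV R d 0 (Num.sqrt a)).
  exact: measurable_normal_rV.
split=> [//|x|A mA]; first exact: normal_rV_ge0.
have := @ge0_integral_normal_rVD R d (Num.sqrt a) 0%R (fun x => (\1_A x)%:E) s0.
under eq_integral do rewrite addr0.
rewrite integral_indic// setIT => ->//.
- rewrite [RHS]integral_mkcond; apply: eq_integral => x _.
  by rewrite patchE indicE; case: ifP; rewrite (mul1e, mul0e).
exact/measurable_EFinP.
Qed.

Lemma normal_peak_ler_normal_rV d (s : R) (m x : 'rV[R]_d) : s != 0%R ->
  (normal_rV m s x <= normal_peak s ^+ d)%R.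
Proof.
move=> s0; rewrite /normal_rV -[X in (_ ^+ X)%R]card_ord -prodr_const.
by apply: ler_prod => i _; rewrite normal_pdf_ge0 normal_pdf_ub.
Qed.

Lemma normal_mixture_fin_num d (s : R) (nu : probability 'rV[R]_d R) x : s != 0%R ->
  \int[nu]_y (normal_rV y s x)%:E \is a fin_num.
Proof.
move=> s0; rewrite ge0_fin_numE; last first.
  by apply: integral_ge0 => y _; rewrite lee_fin normal_rV_ge0.
apply: (@le_lt_trans _ _ (\int[nu]_y (normal_peak s ^+ d)%:E)).
  apply: ge0_le_integral => //.
  - by move=> y _; rewrite lee_fin normal_rV_ge0.
  - by apply/measurable_EFinP; exact: measurable_normal_rV.
  - by move=> y _; rewrite lee_fin normal_peak_ler_normal_rV.
by rewrite integral_cst//= probability_setT mule1 ltry.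
Qed.

(** For fixed [y] the shift passes into the Gaussian density, and Tonelli then moves the integral
    over [y] inside. [fine] makes the density real-valued; the mixture is finite because its kernel
    is bounded. *)
Lemma convolution_density d (a : R) (mu nu : probability 'rV[R]_d R) :
  (0 < a)%R ->
  (forall A, measurable A -> mu A = convolution (gaussian d a) nu A) ->
  is_density mu (fun x => fine (\int[nu]_y (normal_rV y (Num.sqrt a) x)%:E)).
Proof.
move=> a0 muE; set s := Num.sqrt a.
have s0 : s != 0%R by rewrite gt_eqF// sqrtr_gt0.
have mK : measurable_fun setT
    (fun z : 'rV[R]_d * 'rV[R]_d => (normal_rV z.2 s z.1)%:E).
  apply/measurable_EFinP; apply: measurable_normal_rV; first exact: s0.
    exact: measurable_snd.
  exact: measurable_fst.
have K0 (z : 'rV[R]_d * 'rV[R]_d) : 0 <= (normal_rV z.2 s z.1)%:E.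
  by rewrite lee_fin normal_rV_ge0.
split.
- apply: measurableT_comp => //.
  exact: (measurable_fun_fubini_tonelli_F
    (fun z : 'rV[R]_d * 'rV[R]_d => (normal_rV z.2 s z.1)%:E)).
- by move=> x; rewrite fine_ge0// integral_ge0// => y _; rewrite lee_fin normal_rV_ge0.
move=> A mA; rewrite muE// /convolution /pushforward.
have mD : measurable_fun setT (fun z : 'rV[R]_d * 'rV[R]_d => (z.1 + z.2)%R).
  by apply: measurable_fun_addrV; [exact: measurable_fst|exact: measurable_snd].
have mI : measurable_fun setT (fun x : 'rV[R]_d => (\1_A x)%:E : \bar R).
  exact/measurable_EFinP.
set B := _ @^-1` A.
have mB : measurable B by rewrite -[B]setTI; exact: mD.
transitivity (\int[gaussian d a \x nu]_z (\1_A (z.1 + z.2)%R)%:E).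
  by rewrite -[B]setIT -(integral_indic _ measurableT mB).
rewrite (fubini_tonelli2 (m1 := gaussian d a) (m2 := nu)
  (fun z : 'rV[R]_d * 'rV[R]_d => (\1_A (z.1 + z.2)%R)%:E)); last 2 first.
- exact: (measurableT_comp mI mD).
- by move=> z; rewrite lee_fin.
transitivity (\int[nu]_y \int[lebesgue_rV d]_x
    ((\1_A x)%:E * (normal_rV y s x)%:E)).
  apply: eq_integral => y _.
  apply: (ge0_integral_normal_rVD y s0 mI).
  by move=> x; rewrite lee_fin.
rewrite -(fubini_tonelli (m1 := lebesgue_rV d) (m2 := nu)
  (fun z : 'rV[R]_d * 'rV[R]_d => (\1_A z.1)%:E * (normal_rV z.2 s z.1)%:E)); last 2 first.
- by apply: emeasurable_funM; [exact: (measurableT_comp mI measurable_fst)|exact: mK].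
- by move=> z; apply: mule_ge0; [rewrite lee_fin|exact: K0].
rewrite [RHS]integral_mkcond; apply: eq_integral => x _; rewrite patchE /fubini_F/=.
rewrite fineK ?normal_mixture_fin_num// indicE; case: ifP => _.
  by under eq_integral do rewrite mul1e.
by under eq_integral do rewrite mul0e; rewrite integral0.
Qed.

End densities.

(** * Majorization for laws on a cube and for Gaussian mixtures *)

Section gaussian_majorized.
Context {R : realType}.
Local Open Scope ereal_scope.

Lemma lebesgue_cube d (c : 'rV[R]_d) b : (0 <= b)%R ->
  lebesgue_rV d (cube c b) = ((2 * b) ^+ d)%:E.
Proof.
move=> b0; have E n (e : 'rV[R]_n) :
    lebesgue_rV n (cube e b) = \int[lebesgue_rV n]_x (\1_(cube e b) x)%:E.
  by rewrite integral_indic ?setIT//; exact: measurable_cube.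
elim: d c => [|n IHn] c.
  have c0 : cube c b 0%R by move=> [].
  by rewrite /= diracE mem_set ?expr0.
rewrite E ge0_integral_rV_cons; last 2 first.
- by apply/measurable_EFinP/measurable_indic; exact: measurable_cube.
- by move=> x; rewrite lee_fin.
pose I := `[c ord0 ord0 - b, c ord0 ord0 + b]%classic%R.
have consE (u : R) v :
    \1_(cube c b) (rV_cons (u, v)) = (\1_I u * \1_(cube (row_tail c) b) v)%R :> R.
  rewrite !indicE -natrM mulnb; congr (_%:R); congr nat_of_bool.
  apply/idP/andP => [/set_mem H|[/set_mem uI /set_mem vC]].
    split; apply/mem_set.
      have := H ord0; rewrite mxE unlift_none /= ler_norml /I /= in_itv/=.
      by move=> /andP[? ?]; apply/andP; split; lra.
    by move=> i; have := H (lift ord0 i); rewrite !mxE liftK.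
  apply/mem_set => i; move: uI; rewrite /I/= in_itv/= => /andP[? ?].
  rewrite mxE; case: unliftP => [j ->|->] /=; last first.
    by rewrite ler_norml; apply/andP; split; lra.
  by have := vC j; rewrite mxE.
transitivity (\int[lebesgue_measure]_u ((\1_I u)%:E * ((2 * b) ^+ n)%:E)).
  apply: eq_integral => u _; rewrite -(IHn (row_tail c)) E -ge0_integralZl//; last first.
    by apply/measurable_EFinP/measurable_indic; exact: measurable_cube.
  by apply: eq_integral => v _; rewrite consE EFinM.
have b20 : (0 <= (2 * b) ^+ n)%R by rewrite exprn_ge0// mulr_ge0.
rewrite ge0_integralZr//; last first.
  by apply/measurable_EFinP/measurable_indic; exact: measurable_itv.
have -> : \int[lebesgue_measure]_u (\1_I u)%:E = lebesgue_measure I.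
  rewrite integral_indic//; last exact: measurable_itv.
  by congr (lebesgue_measure _); exact: setIT.
rewrite /I lebesgue_measure_itv/= lte_fin exprS EFinM; congr (_ * _).
case: ltP => H; first by rewrite -EFinB; congr EFin; ring.
have -> : b = 0%R by lra.
by rewrite mulr0.
Qed.

(** Each factor is at most [1 / sqrt (2 pi)], and [2 pi >= 4]. *)
Lemma normal_rV_le_half d (x : 'rV[R]_d) : (normal_rV 0 1 x <= 2 ^- d)%R.
Proof.
apply: (le_trans (normal_peak_ler_normal_rV _ _ (oner_neq0 _))).
rewrite -exprVn lerXn2r ?nnegrE ?normal_peak_ge0 ?invr_ge0//.
have pi4 : (2 ^+ 2 <= pi *+ 2 :> R)%R by have := pi_ge2 R; lra.
have sqrt2 : (2 <= Num.sqrt (pi *+ 2) :> R)%R.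
  by rewrite (le_trans _ (ler_wsqrtr pi4))// sqrtr_sqr ger0_norm.
rewrite /normal_peak expr1n mul1r lef_pV2 ?posrE//.
by rewrite (lt_le_trans _ sqrt2).
Qed.

Lemma gaussian_majorized_cube d (mu : probability 'rV[R]_d R) p (c : 'rV[R]_d) :
  is_density mu p -> {ae mu, forall x, cube c 1 x} ->
  majorized (gaussian d 1) mu.
Proof.
move=> dp muC; have [mp p0 muE] := dp.
have dg : is_density (gaussian d 1) (@normal_rV R d 0 1).
  by have := gaussian_density d (@ltr01 R); rewrite sqrtr1.
have [mg g0 gE] := dg.
apply: (majorized_of_density dg dp) => t t0.
(* This number separates the two integrals; [2 ^+ d] is the volume of the cube. *)
pose m : R := Num.max (1 - t * 2 ^+ d)%R 0%R.
have m0 : (0 <= m)%R by rewrite le_max lexx orbT.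
have mC := measurable_cube c 1.
apply: (@le_trans _ _ m%:E).
  apply: (@le_trans _ _ (\int[lebesgue_rV d]_x (m%:E * (normal_rV 0 1 x)%:E))).
    apply: ge0_le_integral; first exact: measurableT.
    - by move=> x _; exact: excess_ge0.
    - by apply: measurable_excess; exact/measurable_EFinP.
    - by apply: measurable_funeM; exact/measurable_EFinP.
    - move=> x _; rewrite /excess -EFinB -EFin_max -EFinM lee_fin.
      have := normal_rV_le_half x; have := g0 x; move: (normal_rV 0 1 x) => g g_ge0.
      rewrite -[(2 ^- d)%R]mul1r ler_pdivlMr ?exprn_gt0// => g_le.
      rewrite ge_max mulr_ge0// andbT.
      (* From [2 ^+ d * g <= 1], subtracting [t] takes away at least [t * 2 ^+ d * g]. *)
      apply: (@le_trans _ _ ((1 - t * 2 ^+ d) * g)%R).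
        by rewrite mulrBl mul1r lerD2l lerN2 -mulrA ler_piMr// mulrC.
      by rewrite ler_wpM2r// le_max lexx.
  rewrite ge0_integralZl ?lee_fin//; last 2 first.
  - exact/measurable_EFinP.
  - by move=> x _; rewrite lee_fin.
  have <- := gE _ measurableT.
  by rewrite probability_setT mule1.
have pC : \int[lebesgue_rV d]_(x in cube c 1) (p x)%:E = 1.
  rewrite -muE//; have muN : mu (~` cube c 1) = 0.
    by apply/negligibleP => //; exact: measurableC.
  have := probability_setC mu (measurableC mC).
  by rewrite setCK muN sube0.
rewrite -[leRHS]adde0 /m EFin_max ge_max; apply/andP; split; last first.
  by rewrite adde0; apply: integral_ge0 => x _; exact: excess_ge0.
rewrite adde0 EFinB leeBlDr//.
have tC : \int[lebesgue_rV d]_(x in cube c 1) t%:E = (t * 2 ^+ d)%:E.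
  transitivity (t%:E * lebesgue_rV d (cube c 1)); first exact: integral_cst.
  by rewrite lebesgue_cube// mulr1.
rewrite -pC -tC.
have mex : measurable_fun setT (fun x => excess t (p x)%:E).
  by apply: measurable_excess; exact/measurable_EFinP.
(* On the cube [p] is at most its excess plus [t], and there [p] has mass 1. *)
apply: (@le_trans _ _ (\int[lebesgue_rV d]_(x in cube c 1) excess t (p x)%:E +
    \int[lebesgue_rV d]_(x in cube c 1) t%:E)); last first.
  apply: leeD2r; apply: ge0_subset_integral => //.
  by move=> x _; exact: excess_ge0.
rewrite -ge0_integralD//; last 2 first.
- by move=> x _; exact: excess_ge0.
- exact: measurable_funTS.
apply: ge0_le_integral => //.
- by move=> x _; rewrite lee_fin.
- by apply: measurable_funTS; exact/measurable_EFinP.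
- by apply: emeasurable_funD => //; exact: measurable_funTS.
- by move=> x _; exact: le_excessD.
Qed.

Lemma gaussian_majorized_mixture d (a b : R) (mu nu : probability 'rV[R]_d R)
    (c : 'rV[R]_d) :
  (0 < a)%R -> (Num.sqrt a * expR (b ^+ 2 / (2 * a)) <= 1)%R ->
  (forall A, measurable A -> mu A = convolution (gaussian d a) nu A) ->
  {ae nu, forall x, cube c b x} ->
  majorized (gaussian d 1) mu.
Proof.
move=> a0 ab muE nuC; have s0 : (0 < Num.sqrt a)%R by rewrite sqrtr_gt0.
have sN0 : Num.sqrt a != 0%R by rewrite gt_eqF.
have dg : is_density (gaussian d 1) (@normal_rV R d 0 1).
  by have := gaussian_density d (@ltr01 R); rewrite sqrtr1.
apply: (majorized_of_density dg (convolution_density a0 muE)) => t t0.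
have mC := measurable_cube c b.
(* With the indicator of the cube as weight, confinement almost everywhere becomes confinement
   wherever the weight is nonzero, and no integral against [nu] changes. *)
pose w (y : 'rV[R]_d) : \bar R := (\1_(cube c b) y)%:E.
have mw : measurable_fun setT w by apply/measurable_EFinP/measurable_indic.
have w0 y : 0 <= w y by rewrite lee_fin.
have wae (f : 'rV[R]_d -> \bar R) : measurable_fun setT f -> (forall y, 0 <= f y) ->
    \int[nu]_y (w y * f y) = \int[nu]_y f y.
  move=> mf f0; apply: ge0_ae_eq_integral => //.
  - exact: emeasurable_funM.
  - by move=> y _; apply: mule_ge0.
  - move: nuC; apply: filterS => y Cy _.
    by rewrite /w indicE mem_set// mul1e.
have w1 : \int[nu]_y w y = 1.
  transitivity (\int[nu]_y (w y * cst 1 y)).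
    by apply: eq_integral => y _; rewrite mule1.
  by rewrite wae// integral_cst//= probability_setT mule1.
have sa : (Num.sqrt a * expR (b ^+ 2 / (2 * Num.sqrt a ^+ 2)) <= 1)%R.
  by rewrite sqr_sqrtr ?(ltW a0).
have wfin : \int[nu]_y w y < +oo by rewrite w1 ltry.
have H := @excess_mixture R _ _ nu b (Num.sqrt a) t d w id c s0 sa t0 mw w0
  wfin (@measurable_id _ _ _).
rewrite w1 in H; apply: le_trans (le_trans (H _) _).
- rewrite le_eqVlt; apply/orP; left; apply/eqP.
  by apply: eq_integral => x _; rewrite mul1e.
- move=> y i wy; have : y \in cube c b.
    by apply: contraNT wy => /negbTE yC; rewrite /w indicE yC.
  by rewrite inE; apply.
- rewrite le_eqVlt; apply/orP; left; apply/eqP.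
  apply: eq_integral => x _; rewrite fineK ?normal_mixture_fin_num//.
  congr (excess t _); rewrite wae//.
    by apply/measurable_EFinP; exact: measurable_normal_rV.
  by move=> y; rewrite lee_fin normal_rV_ge0.
Qed.

End gaussian_majorized.

(** * Enclosing cubes from the two bounds on diameters *)

Theorem corollary6 (R : realType) (d : nat) (mu : probability 'rV[R]_d R) :
  (forall kappa D : R,
     kappa_log_concave kappa mu ->
     diam (msupport mu) = D%:E ->
     kappa * D ^+ 2 < 1 ->
     expR ((1 - kappa * (D ^+ 2 / 4)) / 2) * (D / 2) <= 1 ->
     majorized (gaussian d 1) mu) /\
  (forall (a : R) (nu : probability 'rV[R]_d R),
     0 < a ->
     (forall A : set 'rV[R]_d, measurable A ->
        mu A = convolution (gaussian d a) nu A) ->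
     ((Num.sqrt a)%:E *
        expeR (diam (msupport nu) ^+ 2 * ((8 * a)^-1)%:E) <= 1)%E ->
     majorized (gaussian d 1) mu).
Proof.
split=> [kappa D [_ [p [dp _ _ _]]] muD kD eD|a nu a0 muE].
  have [c muc] : exists c, msupport mu `<=` cube c (D / 2).
    by apply: diam_cube; rewrite muD.
  apply: (gaussian_majorized_cube (c := c) dp).
  apply: msupport_cube_ae => x /muc xc i; apply: le_trans (xc i) _.
  have [D0|/ltW D0] := leP D 0; first by lra.
  (* The exponent is nonnegative because [kappa * D ^+ 2 < 1], so the exponential is at least 1 and
     [eD] gives [D / 2 <= 1]. *)
  apply: le_trans eD; rewrite ler_peMl ?divr_ge0//.
  by apply: le_trans (expR_ge1Dx _); rewrite lerDl divr_ge0//; lra.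
have sa_gt0 : 0 < Num.sqrt a by rewrite sqrtr_gt0.
have ia_gt0 : 0 < (8 * a)^-1 by rewrite invr_gt0 mulr_gt0.
case E : (diam (msupport nu)) => [D| |].
- rewrite -EFin_expe -EFinM /= lee_fin => aD.
  have [c nuc] : exists c, msupport nu `<=` cube c (D / 2).
    by apply: diam_cube; rewrite E.
  apply: (gaussian_majorized_mixture a0 _ muE (msupport_cube_ae nuc)).
  by rewrite (_ : (D / 2) ^+ 2 / (2 * a) = D ^+ 2 * (8 * a)^-1)//; field; lra.
(* The diameter [+oo], and likewise [-oo], the value for an empty set, has square [+oo], which the
   bound by 1 excludes. *)
- by rewrite expe2 mulyy gt0_mulye ?lte_fin//= gt0_muley ?lte_fin// leye_eq.
- by rewrite expe2 mulNyNy gt0_mulye ?lte_fin//= gt0_muley ?lte_fin// leye_eq.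
Qed.
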